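(* Let $q$ be a prime power, $t\ge1$ and $n\ge1$. The Möbius number $\mu(B_n^{(t)}(q))$ equals $(-1)^{n-2}W_n^{(t)}(q)$, where \[W_n^{(t)}(q)=\sum_{(\sigma_1,\ldots,\sigma_t)}\prod_{i=1}^tq^{\mathrm{inv}(\sigma_i)},\] the sum ranging over all $t$-tuples $(\sigma_1,\ldots,\sigma_t)$ of permutations in $\mathfrak{S}_n$ with no common ascent.
   Context: $B_n(q)$ is the lattice of subspaces of $\mathbb{F}_q^n$ ordered by inclusion. For $t\ge2$, $B_n^{(t)}(q)$ is the subposet of $B_n(q)\times\cdots\times B_n(q)$ ($t$ factors, componentwise order) of $t$-tuples of subspaces of equal dimension; $B_n^{(1)}(q)=B_n(q)$. The Möbius number is $\mu(\hat0,\hat1)$. $\mathrm{inv}(\sigma)$ is the number of pairs $i<j$ with $\sigma(i)>\sigma(j)$; an ascent of $\sigma$ is $i\in[n-1]$ with $\sigma(i)<\sigma(i+1)$, and a common ascent of a $t$-tuple is an index that is an ascent of every entry. *)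

(* Defs.v *)
From HB Require Import structures.
From mathcomp Require Import all_boot all_order all_fingroup all_algebra.

Set Implicit Arguments.
Unset Strict Implicit.
Unset Printing Implicit Defensive.

Import Order.TTheory GRing.Theory Num.Theory.

(* The Möbius function of a finite poset, with values in int. The recursion is
   run with fuel [#|T|], which bounds the length of every chain; [mobius_refl],
   [mobius_lt] and [mobius_nle] below are the usual defining equations. *)
Section Mobius.
Context {d : Order.disp_t} {T : finPOrderType d}.
Local Open Scope ring_scope.

Fixpoint mobius_rec (k : nat) (x y : T) : int :=
  if x == y then 1
  else if k is k'.+1 then
    - \sum_(z : T | (x <= z)%O && (z < y)%O) mobius_rec k' x z
  else 0.

Definition mobius (x y : T) : int := mobius_rec #|T| x y.

Lemma mobius_rec_fuel k l (x y : T) :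
  (#|[set z : T | (x < z <= y)%O]| <= k)%N ->
  (#|[set z : T | (x < z <= y)%O]| <= l)%N ->
  mobius_rec k x y = mobius_rec l x y.
Proof.
elim: k l y => [|k IHk] [|l] y //= hk hl; case: eqVneq => // neq_xy.
- rewrite big1 ?oppr0 // => z /andP[xz zy].
  have : y \in [set z : T | (x < z <= y)%O].
    by rewrite inE lexx andbT (le_lt_trans xz zy).
  by move: hk; rewrite leqn0 cards_eq0 => /eqP ->; rewrite inE.
- rewrite big1 ?oppr0 // => z /andP[xz zy].
  have : y \in [set z : T | (x < z <= y)%O].
    by rewrite inE lexx andbT (le_lt_trans xz zy).
  by move: hl; rewrite leqn0 cards_eq0 => /eqP ->; rewrite inE.
congr (- _); apply: eq_bigr => z /andP[xz zy].
have sub : [set w : T | (x < w <= z)%O] \proper [set w : T | (x < w <= y)%O].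
  apply/properP; split.
    apply/subsetP=> w; rewrite !inE => /andP[-> wz] /=.
    exact: le_trans wz (ltW zy).
  exists y; rewrite inE ?lexx ?andbT ?(le_lt_trans xz zy) //.
  by rewrite (lt_geF zy) andbF.
have lt_c := proper_card sub.
by apply: IHk; rewrite -ltnS; apply: leq_trans lt_c _.
Qed.

Lemma mobius_refl (x : T) : mobius x x = 1.
Proof. by rewrite /mobius; case: #|T| => [|k] /=; rewrite eqxx. Qed.

Lemma mobius_lt (x y : T) : (x < y)%O ->
  mobius x y = - \sum_(z : T | (x <= z)%O && (z < y)%O) mobius x z.
Proof.
move=> xy; rewrite /mobius.
rewrite (@mobius_rec_fuel _ #|T|.+1) ?(leqW (max_card _)) ?max_card //=.
by rewrite (lt_eqF xy).
Qed.

Lemma mobius_nle (x y : T) : ~~ (x <= y)%O -> mobius x y = 0.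
Proof.
move=> nxy; rewrite /mobius; case: #|T| => [|k] /=.
  by case: eqVneq nxy => // ->; rewrite lexx.
case: eqVneq nxy => [->|_ nxy]; first by rewrite lexx.
rewrite big1 ?oppr0 // => z /andP[xz zy].
by rewrite (le_trans xz (ltW zy)) in nxy.
Qed.

End Mobius.

Definition mobius_number {d : Order.disp_t} (T : finTBPOrderType d) : int :=
  mobius (\bot%O : T) (\top%O : T).

Fact subspace_display : Order.disp_t. Proof. exact: Order.Disp tt tt. Qed.

Section SubspaceLattice.
Variables (F : finFieldType) (n : nat).

Definition subspace : Type := {vspace 'rV[F]_n}.

HB.instance Definition _ := SubChoice.copy subspace {vspace 'rV[F]_n}.
HB.instance Definition _ := [Finite of subspace by <:].

Definition le_subspace (U V : subspace) : bool := (U <= V)%VS.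

Fact le_subspace_refl : reflexive le_subspace.
Proof. exact: subvv. Qed.

Fact le_subspace_anti : antisymmetric le_subspace.
Proof. by move=> U V UV; apply/eqP; rewrite eqEsubv. Qed.

Fact le_subspace_trans : transitive le_subspace.
Proof. by move=> V U W; apply: subv_trans. Qed.

HB.instance Definition _ := Order.Le_isPOrder.Build subspace_display subspace
  le_subspace_refl le_subspace_anti le_subspace_trans.

Fact le0_subspace (U : subspace) : ((0%VS : subspace) <= U)%O.
Proof. exact: sub0v. Qed.

Fact le_subspace1 (U : subspace) : (U <= (fullv : subspace))%O.
Proof. exact: subvf. Qed.

HB.instance Definition _ :=
  Order.hasBottom.Build subspace_display subspace le0_subspace.
HB.instance Definition _ :=
  Order.hasTop.Build subspace_display subspace le_subspace1.

End SubspaceLattice.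

Section EqualDimension.
Variables (F : finFieldType) (n t : nat).

Definition equidim (x : t.-tupleprod (subspace F n)) : bool :=
  [forall i, forall j, \dim (tnth x i) == \dim (tnth x j)].

(* B_n^(t)(q). For t = 1 this is B_n(q) up to the identification of 1-tuples
   with their entry, see [Bnt1_iso]. *)
Record Bnt : Type := MkBnt {
  Bnt_val : t.-tupleprod (subspace F n);
  Bnt_equidim : equidim Bnt_val }.

HB.instance Definition _ := [isSub for Bnt_val].
HB.instance Definition _ := [Finite of Bnt by <:].
HB.instance Definition _ :=
  [SubChoice_isSubPOrder of Bnt by <: with subspace_display].

Fact equidim_bot : equidim \bot%O.
Proof. by apply/forallP=> i; apply/forallP=> j; rewrite botEtprod !tnth_mktuple. Qed.

Fact equidim_top : equidim \top%O.
Proof. by apply/forallP=> i; apply/forallP=> j; rewrite topEtprod !tnth_mktuple. Qed.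

Fact Bnt_le0 (x : Bnt) : (MkBnt equidim_bot <= x)%O.
Proof. exact: (@le0x _ (t.-tupleprod (subspace F n))). Qed.

Fact Bnt_le1 (x : Bnt) : (x <= MkBnt equidim_top)%O.
Proof. exact: (@lex1 _ (t.-tupleprod (subspace F n))). Qed.

HB.instance Definition _ := Order.hasBottom.Build subspace_display Bnt Bnt_le0.
HB.instance Definition _ := Order.hasTop.Build subspace_display Bnt Bnt_le1.

Lemma le_BntP (x y : Bnt) :
  reflect (forall i, (tnth (val x) i <= tnth (val y) i)%VS) (x <= y)%O.
Proof. by rewrite -[(x <= y)%O]/(val x <= val y)%O leEtprod; apply: forallP. Qed.

End EqualDimension.

Lemma Bnt1_iso (F : finFieldType) (n : nat) :
  exists2 f : Bnt F n 1 -> subspace F n, bijective f &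
    {mono f : x y / (x <= y)%O}.
Proof.
exists (fun x => tnth (val x) ord0); last first.
  move=> x y; apply/idP/le_BntP=> [le_xy i|]; last exact.
  by rewrite (ord1 i).
have eqd U : equidim ([tuple U] : 1.-tupleprod (subspace F n)).
  by apply/forallP=> i; apply/forallP=> j; rewrite (ord1 i) (ord1 j).
exists (fun U => MkBnt (eqd U)) => [x|U]; last exact: tnth0.
by apply/val_inj/eq_from_tnth => i /=; rewrite (ord1 i) tnth0.
Qed.

Definition ninv n (s : 'S_n) : nat :=
  #|[set p : 'I_n * 'I_n | (p.1 < p.2) && (s p.1 > s p.2)]|.

(* Positions are numbered from 0, so an ascent is an i with i + 1 < n. *)
Definition is_ascent n (s : 'S_n) (i : nat) : bool :=
  [exists a : 'I_n, exists b : 'I_n,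
    [&& val a == i, val b == i.+1 & s a < s b]].

Definition no_common_ascent n t (s : t.-tuple 'S_n) : bool :=
  ~~ [exists i : 'I_n.-1, forall k : 'I_t, is_ascent (tnth s k) i].

Definition Wnt (n t q : nat) : nat :=
  \sum_(s : t.-tuple 'S_n | no_common_ascent s)
    \prod_(k < t) q ^ ninv (tnth s k).

Definition prime_power (q : nat) : Prop :=
  exists p k : nat, [/\ prime p, 0 < k & q = p ^ k].

(* Main.v *)
Require Import Defs.
From mathcomp Require Import all_boot all_order all_fingroup all_algebra.
From mathcomp Require Import finfield zify ring.

(** The interval below an element of dimension [d] contains
    [binom(d, k)_q ^ t] elements of dimension [k], so by induction the Möbius
    function from the bottom equals [(-1)^d W_d] as soon as
    [sum_k (-1)^k binom(d, k)_q^t W_k = 0] for [d > 0].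

    For the latter, record a permutation [s] by its code: entry [i] is the
    number of [j < i] with [s j > s i], which lies in [0 .. i]. The code sums
    to [inv s], and [i] is an ascent iff entry [i + 1] is at most entry [i].
    Hence [binom(d, k)_q^t W_k] enumerates the t-tuples of codes of length [d]
    without common ascent among the first [k] positions and weakly decreasing
    afterwards, [binom(d, k)_q] counting the partitions in a
    [k] by [(d - k)] box. Whether or not the junction of the two parts is a
    common ascent splits this set in two pieces, shared with the terms [k - 1]
    and [k + 1], and the alternating sum telescopes. *)

Set Implicit Arguments.
Unset Strict Implicit.
Unset Printing Implicit Defensive.

Import Order.TTheory GRing.Theory Num.Theory.

(** * Inversions and ascents when a last value is appended *)

Lemma ninv_sum m (s : 'S_m) :
  ninv s = \sum_(j < m) \sum_(i < m | i < j) (s j < s i).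
Proof.
rewrite /ninv cardsE -sum1_card.
rewrite (eq_bigl (fun p : 'I_m * 'I_m => (p.1 < p.2) && (s p.2 < s p.1))) //.
rewrite -(pair_big_dep predT (fun i j : 'I_m => (i < j) && (s j < s i))
  (fun _ _ => 1)) /= (exchange_big_dep predT) //=.
apply: eq_bigr => j _; rewrite big_mkcondr /=.
by apply: eq_bigr => i _; case: (s j < s i).
Qed.

Lemma sum_ord_geq m (a : nat) : \sum_(i < m) (a <= i) = m - a.
Proof.
elim: m => [|m IHm]; first by rewrite big_ord0.
by rewrite big_ord_recr /= IHm; case: leqP; lia.
Qed.

Lemma is_ascentE m (s : 'S_m) (a b : 'I_m) : val b = (val a).+1 ->
  is_ascent s a = (s a < s b).
Proof.
move=> ba; apply/existsP/idP => [[a' /existsP[b' /and3P[/eqP ea /eqP eb]]]|lt_ab].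
  by have [-> ->] : a' = a /\ b' = b by split; apply: val_inj; rewrite // eb ba.
by exists a; apply/existsP; exists b; rewrite eqxx ba eqxx.
Qed.

Section LastEntry.
Variable n : nat.
Implicit Types (p : 'S_n) (a : 'I_n.+1).

Lemma widen_lift_max (i : 'I_n) : widen_ord (leqnSn n) i = lift ord_max i.
Proof. by apply: val_inj; rewrite /= /bump leqNgt ltn_ord. Qed.

Lemma ltn_lift a (i j : 'I_n) : (lift a i < lift a j) = (i < j).
Proof. by rewrite /= /bump; lia. Qed.

(** The last position is inverted with exactly the [n - a] values above [a]; this is the new code
    entry. The values of [p] are only relabelled increasingly. *)
Lemma ninv_lift_last a p : ninv (lift_perm ord_max a p) = ninv p + (n - a).
Proof.
rewrite !ninv_sum big_ord_recr /=; congr (_ + _).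
  apply: eq_bigr => j _; rewrite big_mkcond big_ord_recr /= ltnNge ltnW //=.
  rewrite addn0 [RHS]big_mkcond; apply: eq_bigr => i _.
  by rewrite !widen_lift_max !lift_perm_lift ltn_lift.
rewrite big_mkcond big_ord_recr /= ltnn addn0.
rewrite -sum_ord_geq [RHS](reindex_inj (@perm_inj _ p)) /=.
apply: eq_bigr => i _; rewrite ltn_ord widen_lift_max lift_perm_lift lift_perm_id.
by congr nat_of_bool; rewrite /= /bump; lia.
Qed.

Lemma is_ascent_lift_last a p i : i.+1 < n ->
  is_ascent (lift_perm ord_max a p) i = is_ascent p i.
Proof.
move=> lt_in; have lt_in' := ltnW lt_in.
rewrite -[i]/(val (Ordinal lt_in')) (@is_ascentE _ p _ (Ordinal lt_in)) //.
have -> : val (Ordinal lt_in') = val (lift ord_max (Ordinal lt_in')).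
  by rewrite -widen_lift_max.
rewrite (@is_ascentE _ _ _ (lift ord_max (Ordinal lt_in))); last first.
  by rewrite -!widen_lift_max.
by rewrite !lift_perm_lift ltn_lift.
Qed.

Lemma lift_last_inj :
  injective (fun ap : 'I_n.+1 * 'S_n => lift_perm ord_max ap.1 ap.2).
Proof.
move=> [a p] [b r] /= /permP eq_s.
have eq_ab : a = b by have := eq_s ord_max; rewrite !lift_perm_id.
congr (_, _) => //; apply/permP => i.
by have := eq_s (lift ord_max i); rewrite !lift_perm_lift eq_ab => /lift_inj.
Qed.

End LastEntry.

(** Relabelling raises the value [p ord_max] by one iff it is at least [a], so it ends below [a]
    exactly when it started there. *)
Lemma is_ascent_last n (a : 'I_n.+2) (p : 'S_n.+1) :
  is_ascent (lift_perm ord_max a p) n = (p ord_max < a).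
Proof.
have nE : val (lift ord_max (@ord_max n)) = n by rewrite -widen_lift_max.
rewrite -[X in is_ascent _ X]nE (@is_ascentE _ _ _ ord_max) ?nE //.
by rewrite lift_perm_lift lift_perm_id /= /bump; lia.
Qed.

Section Tuples.
Variables (t n : nat).

Definition lift_last_tuple (x : t.-tuple 'S_n * {ffun 'I_t -> 'I_n.+1}) :
  t.-tuple 'S_n.+1 :=
  [tuple lift_perm ord_max (x.2 k) (tnth x.1 k) | k < t].

(** Injectivity is checked entrywise; both sides have [(n+1)!^t] elements. *)
Lemma lift_last_tuple_bij : bijective lift_last_tuple.
Proof.
apply: inj_card_bij.
  move=> [p a] [r b] /(congr1 (@tnth _ _)) /= eq_s.
  have eq_k k : (a k, tnth p k) = (b k, tnth r k).
    apply: lift_last_inj; move/(congr1 (@^~ k)): eq_s.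
    by rewrite !tnth_mktuple.
  congr (_, _); first by apply: eq_from_tnth => k; case: (eq_k k).
  by apply/ffunP => k; case: (eq_k k).
by rewrite card_prod !card_tuple card_ffun !card_ord !card_Sn factS expnMn mulnC.
Qed.

End Tuples.

Lemma no_common_ascent_lift_last t n (p : t.-tuple 'S_n.+1)
    (a : {ffun 'I_t -> 'I_n.+2}) :
  no_common_ascent (lift_last_tuple (p, a)) =
  no_common_ascent p && ~~ [forall k, tnth p k ord_max < a k].
Proof.
rewrite /no_common_ascent -negb_or; congr negb.
apply/existsP/orP => [[i /forallP asc]|[/existsP[i /forallP asc]|/forallP asc]].
- case: (ltnP i n) => [lt_in|le_ni]; [left|right].
    apply/existsP; exists (Ordinal lt_in); apply/forallP=> k; move: (asc k).
    by rewrite tnth_mktuple is_ascent_lift_last.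
  apply/forallP=> k; have := asc k; rewrite tnth_mktuple.
  have -> : val i = n by apply/eqP; rewrite eqn_leq le_ni -ltnS ltn_ord.
  by rewrite is_ascent_last.
- exists (widen_ord (leqnSn n) i); apply/forallP => k.
  by rewrite tnth_mktuple is_ascent_lift_last ?asc //= ltnS.
- by exists ord_max; apply/forallP => k; rewrite tnth_mktuple is_ascent_last asc.
Qed.

(** * The telescoping alternating sum *)

Section Telescoping.
Local Open Scope ring_scope.
Variables (R : comNzRingType) (q : R) (t : nat).

(** Total weight of appending a code entry [b] in [0 .. d], where [h b] weighs what follows it. *)
Definition qsum (h : nat -> R) (d : nat) : R := \sum_(b < d.+1) q ^+ b * h b.

(* The argument [n - s ord_max] of [h] is the last entry of the code of [s]. *)
Definition Wlast (n : nat) (h : nat -> R) : R :=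
  \sum_(s : t.-tuple 'S_n.+1 | no_common_ascent s)
    \prod_(k < t) (q ^+ ninv (tnth s k) * h (n - tnth s k ord_max)%N).

Lemma qsum_rev (h : nat -> R) n (m : nat) : (m <= n)%N ->
  \sum_(a < n.+1 | (m <= a)%N) q ^+ (n - a) * h (n - a)%N = qsum h (n - m).
Proof.
move=> le_mn; rewrite (reindex_inj rev_ord_inj) /= /qsum.
rewrite (big_ord_widen_cond n.+1 predT (fun b => q ^+ b * h b)); last by lia.
apply: eq_big => [a|a _]; have le_an : (a <= n)%N by rewrite -ltnS.
  by rewrite subSS ltnS !leq_subRL // addnC.
by rewrite subSS subKn.
Qed.

(** Both terms on the left sum over [p] and appended values [a]: the first over those without common
    ascent at the junction, the second over the others, where [n + 1 - a k] is at most
    [n - tnth p k ord_max] for every [k]. Together [a] is unrestricted and its sum factors over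
    [k]. *)
Lemma Wlast_step n (h : nat -> R) :
  Wlast n.+1 h + Wlast n (qsum h) = qsum h n.+1 ^+ t * Wlast n (fun=> 1).
Proof.
rewrite {1}/Wlast (reindex (@lift_last_tuple t n.+1)) /=; last first.
  exact: onW_bij (lift_last_tuple_bij _ _).
rewrite (eq_bigl (fun x : _ * {ffun 'I_t -> 'I_n.+2} => no_common_ascent x.1 &&
  ~~ [forall k, (tnth x.1 k ord_max < x.2 k)%N])); last first.
  by move=> [p a]; rewrite no_common_ascent_lift_last.
rewrite -(pair_big_dep (@no_common_ascent _ _)
  (fun (p : t.-tuple 'S_n.+1) (a : {ffun 'I_t -> 'I_n.+2}) =>
     ~~ [forall k, (tnth p k ord_max < a k)%N])
  (fun p a => \prod_(k < t) (q ^+ ninv (tnth (lift_last_tuple (p, a)) k) *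
       h (n.+1 - tnth (lift_last_tuple (p, a)) k ord_max)%N))) /=.
rewrite -big_split mulr_sumr; apply: eq_bigr => p _ /=.
pose c (k : 'I_t) (a : 'I_n.+2) := q ^+ (n.+1 - a) * h (n.+1 - a)%N.
under eq_bigr => a _.
  under eq_bigr => k _ do
    rewrite tnth_mktuple ninv_lift_last lift_perm_id exprD -mulrA.
  rewrite big_split; over.
rewrite /= -mulr_sumr.
have -> : \prod_(k < t) (q ^+ ninv (tnth p k) * 1) =
  \prod_(k < t) q ^+ ninv (tnth p k) by under eq_bigr do rewrite mulr1.
rewrite big_split /= -mulrDr mulrC; congr (_ * _).
have -> : qsum h n.+1 ^+ t =
    \sum_(a : {ffun 'I_t -> 'I_n.+2}) \prod_(k < t) c k (a k).
  rewrite -(bigA_distr_bigA c) -[in LHS](card_ord t) -prodr_const.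
  by apply: eq_bigr => k _; rewrite -{1}[n.+1]subn0 -qsum_rev.
rewrite [RHS](bigID (fun a : {ffun 'I_t -> 'I_n.+2} =>
  [forall k, (tnth p k ord_max < a k)%N])) /= [RHS]addrC; congr (_ + _).
have qsumE k : qsum h (n - tnth p k ord_max)%N =
    \sum_(a < n.+2 | (tnth p k ord_max < a)%N) c k a.
  by rewrite -subSS -qsum_rev.
under eq_bigr do rewrite qsumE.
rewrite bigA_distr_big_dep; apply: eq_bigl => a.
by apply/familyP/forallP => /= H k; have := H k.
Qed.

(* [qpart m a] enumerates by size the partitions with at most [m] parts, all at
   most [a]; it is the Gaussian binomial coefficient [binom(m + a, a)_q]. *)
Fixpoint qpart (m : nat) : nat -> R :=
  if m is m'.+1 then qsum (qpart m') else fun=> 1.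

Definition Wsum (n : nat) : R :=
  \sum_(s : t.-tuple 'S_n | no_common_ascent s)
    \prod_(k < t) q ^+ ninv (tnth s k).

Lemma WsumS n : Wsum n.+1 = Wlast n (fun=> 1).
Proof.
by apply: eq_bigr => s _; apply: eq_bigr => k _; rewrite mulr1.
Qed.

Lemma perm0 (s : 'S_0) : s = 1%g.
Proof. by apply/permP => -[]. Qed.

Lemma ninv0 (s : 'S_0) : ninv s = 0%N.
Proof. by rewrite ninv_sum big_ord0. Qed.

Lemma ninv1 (s : 'S_1) : ninv s = 0%N.
Proof. by rewrite ninv_sum big_ord1 big_pred0 // => i; rewrite (ord1 i). Qed.

Lemma no_common_ascent_le1 n (s : t.-tuple 'S_n) :
  (n <= 1)%N -> no_common_ascent s.
Proof.
by move=> n1; apply/negP => /existsP[[i ltin] _]; move: ltin n1; lia.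
Qed.

Lemma Wsum0 : Wsum 0 = 1.
Proof.
rewrite /Wsum (big_pred1 [tuple 1%g | k < t]) => [|s].
  by rewrite big1 // => k _; rewrite ninv0.
rewrite no_common_ascent_le1 //; apply/esym/eqP/eq_from_tnth => k.
by rewrite tnth_mktuple [LHS]perm0.
Qed.

Lemma Wlast0 h : Wlast 0 h = h 0%N ^+ t.
Proof.
rewrite /Wlast (big_pred1 [tuple 1%g | k < t]) => [|s].
  under eq_bigr => k _ do rewrite ninv1 ord1 subn0 mul1r.
  by rewrite prodr_const card_ord.
rewrite no_common_ascent_le1 //; apply/esym/eqP/eq_from_tnth => k.
by rewrite tnth_mktuple; apply/permP => i; rewrite [LHS]ord1 [RHS]ord1.
Qed.

Lemma qpart0 m : qpart m 0 = 1.
Proof. by elim: m => //= m IHm; rewrite /qsum big_ord1 IHm mulr1. Qed.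

(* The right-hand side is the piece that the last term of the sum shares with
   its successor. *)
Lemma alternating_partial n m : (m <= n)%N ->
  \sum_(k < m.+1) (-1) ^+ k * qpart (n.+1 - k) k ^+ t * Wsum k =
  (-1) ^+ m * Wlast m (qpart (n - m)).
Proof.
elim: m => [|m IHm] le_mn.
  by rewrite big_ord1 !expr0 !mul1r Wsum0 Wlast0 !qpart0 expr1n mulr1.
rewrite big_ord_recr IHm /= ?(ltnW le_mn) // subSS WsumS -mulrA.
(* This exposes [qpart (n - m)] as [qsum (qpart (n - m.+1))], as [Wlast_step] requires. *)
rewrite (_ : (n - m = (n - m.+1).+1)%N); last by lia.
by rewrite /= -Wlast_step exprS !mulN1r !mulNr mulrDr; ring.
Qed.

(** In the last term no weakly decreasing part is left, so it cancels the partial sum up to [n]. *)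
Lemma alternating_qbinomial_Wsum n :
  \sum_(k < n.+2) (-1) ^+ k * qpart (n.+1 - k) k ^+ t * Wsum k = 0.
Proof.
rewrite big_ord_recr alternating_partial //= !subnn /= expr1n mulr1 WsumS exprS.
by ring.
Qed.

End Telescoping.

(** * Gaussian binomials through q-factorials *)

Section GaussianBinomial.
Local Open Scope ring_scope.
Variables (R : comNzRingType) (q : R).

(** The q-factorial times [(q - 1)^k], which keeps the formulas free of division. *)
Definition qfact (k : nat) : R := \prod_(i < k) (q ^+ i.+1 - 1).

(** For [q] the order of a field, the number of free [k]-tuples in dimension [d]. *)
Definition qfalling (d k : nat) : R := \prod_(i < k) (q ^+ d - q ^+ i).

(** The q-Pascal rule: the largest part is at most [k] or equal to [k + 1]. *)
Lemma qpartSS m k : qpart q m.+1 k.+1 = qpart q m.+1 k + q ^+ k.+1 * qpart q m k.+1.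
Proof. by rewrite /= /qsum big_ord_recr. Qed.

Lemma qpart_qfact m k : qpart q m k * (qfact k * qfact m) = qfact (m + k).
Proof.
elim: m k => [|m IHm] k; first by rewrite /= mul1r /qfact big_ord0 mulr1.
elim: k => [|k IHk]; first by rewrite qpart0 addn0 /qfact big_ord0 !mul1r.
have qfactS j : qfact j.+1 = qfact j * (q ^+ j.+1 - 1) by exact: big_ord_recr.
(* The q-Pascal rule with denominators cleared; the two coefficients add up to [q^(m+k+2) - 1]. *)
transitivity ((q ^+ k.+1 - 1) * qfact (m.+1 + k) +
    q ^+ k.+1 * (q ^+ m.+1 - 1) * qfact (m + k.+1)).
  by rewrite -IHk -IHm qpartSS !qfactS; ring.
rewrite !addnS !addSn (qfactS (m + k).+1).
have -> : q ^+ (m + k).+2 = q ^+ k.+1 * q ^+ m.+1.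
  by rewrite -exprD addSn addnS addnC.
by ring.
Qed.

Lemma qfallingSS d k : qfalling d.+1 k.+1 = (q ^+ d.+1 - 1) * q ^+ k * qfalling d k.
Proof.
rewrite /qfalling big_ord_recl expr0 -mulrA; congr (_ * _).
under eq_bigr => i _ do rewrite /= /bump /= !exprS -mulrBr.
by rewrite big_split prodr_const card_ord.
Qed.

(** Factor [i] yields [q^i], and these exponents add up to ['C(k, 2)]. *)
Lemma qfalling_qfact m k :
  qfalling (m + k) k * qfact m = q ^+ 'C(k, 2) * qfact (m + k).
Proof.
elim: k => [|k IHk]; first by rewrite /qfalling big_ord0 addn0.
rewrite addnS qfallingSS -mulrA IHk /qfact big_ord_recr /= binS bin1 exprD.
by ring.
Qed.

End GaussianBinomial.

(** * Counting subspaces over a finite field *)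

Section CountSubspaces.
Local Open Scope ring_scope.
Variables (F : finFieldType) (n : nat).
Local Notation q := (#|F|%:R : int).
Implicit Types (U V : subspace F n).

Lemma q_gt1 : 1 < q.
Proof. by rewrite (ltr_nat _ 1) card_finRing_gt1. Qed.

Lemma qfact_neq0 k : qfact q k != 0.
Proof.
by apply/prodf_neq0 => i _; rewrite subr_eq0 gt_eqF // exprn_egt1 // q_gt1.
Qed.

Lemma qfalling_qpart m k : qpart q m k * qfalling q k k = qfalling q (m + k) k.
Proof.
apply: (mulIf (qfact_neq0 m)); rewrite qfalling_qfact -qpart_qfact.
have := qfalling_qfact q 0 k; rewrite add0n /qfact big_ord0 mulr1 => ->.
by rewrite -/(qfact q k); ring.
Qed.

Lemma qfalling_neq0 k : qfalling q k k != 0.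
Proof.
apply/prodf_neq0 => i _; rewrite subr_eq0 gt_eqF // ltr_eXn2l ?q_gt1 //.
Qed.

Lemma sum_subvD U V : (U <= V)%VS ->
  \sum_(v in V | v \notin U) 1 = q ^+ \dim V - q ^+ \dim U.
Proof.
move=> UV; apply: (addIr (q ^+ \dim U)); rewrite subrK -!natrX -!card_vspace.
rewrite -!sum1_card !natr_sum [RHS](bigID (mem U)) /= addrC; congr (_ + _).
by apply: eq_bigl => v; rewrite andb_idl // => /(subvP UV).
Qed.

(** A free [k]-tuple in [V] extends by any vector of [V] outside its span, in [q^(dim V) - q^k]
    ways. *)
Lemma sum_free_tuple V k :
  \sum_(X : k.-tuple 'rV[F]_n | free X && (<<X>> <= V)%VS) 1 =
  qfalling q (\dim V) k.
Proof.
elim: k => [|k IHk].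
  rewrite /qfalling big_ord0 (big_pred1 [tuple]) // => X.
  by rewrite tuple0 /= nil_free span_nil sub0v eqxx.
rewrite /qfalling big_ord_recr /= -/(qfalling q (\dim V) k) -IHk mulr_suml.
pose f (Xv : k.-tuple 'rV[F]_n * 'rV[F]_n) := [tuple of Xv.2 :: Xv.1].
rewrite (reindex f); last first.
  exists (fun X : k.+1.-tuple 'rV[F]_n => ([tuple of behead X], thead X)) => [[X v] _|X _] /=.
    by congr (_, _); apply: val_inj.
  by rewrite /f /= -tuple_eta.
rewrite (eq_bigl (fun Xv : k.-tuple _ * _ => (free Xv.1 && (<<Xv.1>> <= V)%VS) &&
    ((Xv.2 \in V) && (Xv.2 \notin <<Xv.1>>%VS)))); last first.
  move=> [X v]; rewrite /= free_cons span_cons subv_add -memvE.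
  by case: (free X); case: (v \in V); rewrite ?andbF ?andbT //= andbC.
rewrite -(pair_big_dep (fun X : k.-tuple 'rV[F]_n => free X && (<<X>> <= V)%VS)
  (fun X v => (v \in V) && (v \notin <<X>>%VS)) (fun _ _ => 1)) /=.
apply: eq_bigr => X /andP[/eqP freeX XV].
by rewrite sum_subvD // mul1r freeX size_tuple.
Qed.

(** Group the free [k]-tuples of [V] by their span: each [U] arises from [qfalling q k k] of them, a
    nonzero number that can be cancelled. *)
Lemma sum_subspaces V k : (k <= \dim V)%N ->
  \sum_(U : subspace F n | (U <= V)%VS && (\dim U == k)) 1 =
  qpart q (\dim V - k) k.
Proof.
move=> le_kd; apply: (mulIf (qfalling_neq0 k)).
rewrite qfalling_qpart subnK // -sum_free_tuple mulr_suml.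
pose Q U := (U <= V)%VS && (\dim U == k).
rewrite [RHS](partition_big
  (fun X : k.-tuple 'rV[F]_n => <<X>>%VS : subspace F n) Q).
  apply: eq_bigr => U /andP[UV /eqP dimU]; rewrite mul1r -[X in qfalling _ X _]dimU.
  rewrite -sum_free_tuple; apply: eq_bigl => X; rewrite -andbA.
  have [freeX /=|//] := boolP (free X).
  rewrite (eqEdim <<X>>%VS U : (_ == _ :> subspace F n) = _) dimU.
  have -> : \dim <<X>> = k by move/eqP: freeX => ->; rewrite size_tuple.
  rewrite leqnn andbT; apply/idP/andP => [XU|[]//].
  by split=> //; apply: subv_trans UV.
by move=> X /andP[/eqP freeX XV]; rewrite /Q XV freeX size_tuple eqxx.
Qed.

End CountSubspaces.

(** * The Möbius function from the bottom *)

Section MobiusBnt.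
Local Open Scope ring_scope.
Variables (F : finFieldType) (n t : nat).
Local Notation q := (#|F|%:R : int).
Implicit Types x z : Bnt F n t.+1.

Definition Bnt_dim x : nat := \dim (tnth (val x) ord0).

Lemma dim_tnth_Bnt x i : \dim (tnth (val x) i) = Bnt_dim x.
Proof. by have /forallP/(_ i)/forallP/(_ ord0)/eqP := Bnt_equidim x. Qed.

Lemma Bnt_dim_le x z : (z <= x)%O -> (Bnt_dim z <= Bnt_dim x)%N.
Proof. by move=> /le_BntP le_zx; apply: dimvS. Qed.

Lemma Bnt_le_dim_eq x z : (z <= x)%O -> Bnt_dim z = Bnt_dim x -> z = x.
Proof.
move=> /le_BntP le_zx eq_d; apply/val_inj/eq_from_tnth => i; apply/eqP.
have := eqEdim (tnth (val z) i) (tnth (val x) i).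
by rewrite le_zx !dim_tnth_Bnt eq_d leqnn => ->.
Qed.

(** Once the dimension is fixed to [k], the components can be chosen independently, as
    equidimensionality is automatic. *)
Lemma sum_Bnt_dim x k : (k <= Bnt_dim x)%N ->
  \sum_(z | (z <= x)%O && (Bnt_dim z == k)) 1 =
  qpart q (Bnt_dim x - k) k ^+ t.+1.
Proof.
move=> le_kd.
pose P i (U : subspace F n) := (U <= tnth (val x) i)%VS && (\dim U == k).
have -> : qpart q (Bnt_dim x - k) k ^+ t.+1 =
    \prod_(i < t.+1) \sum_(U : subspace F n | P i U) 1.
  rewrite -[in LHS](card_ord t.+1) -prodr_const; apply: eq_bigr => i _.
  by rewrite sum_subspaces dim_tnth_Bnt.
rewrite bigA_distr_big_dep.
under [RHS]eq_bigr do rewrite big1_eq.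
pose f z : {ffun 'I_t.+1 -> subspace F n} := [ffun i => tnth (val z) i].
have f_inj : injective f.
  move=> y z /ffunP eq_f; apply/val_inj/eq_from_tnth => i.
  by have := eq_f i; rewrite !ffunE.
rewrite !sumr_const; congr (_ *+ _); rewrite -(card_image f_inj).
apply: eq_card => g; apply/imageP/familyP => [[z /andP[/le_BntP le_zx dimz]] -> i|Pg].
  by rewrite unfold_in /P ffunE le_zx dim_tnth_Bnt.
pose y : t.+1.-tupleprod (subspace F n) := [tuple g i | i < t.+1].
have dimg i : \dim (g i) = k by have /andP[_ /eqP] := Pg i.
have eqdim_y : equidim y.
  by apply/forallP => i; apply/forallP => j; rewrite !tnth_mktuple !dimg.
exists (MkBnt eqdim_y); last by apply/ffunP => i; rewrite ffunE tnth_mktuple.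
rewrite unfold_in /Bnt_dim /= tnth_mktuple dimg eqxx andbT.
by apply/le_BntP => i; rewrite tnth_mktuple; have /andP[] := Pg i.
Qed.

Lemma sum_Bnt_below x (f : nat -> int) :
  \sum_(z | (z <= x)%O) f (Bnt_dim z) =
  \sum_(k < (Bnt_dim x).+1) f k * qpart q (Bnt_dim x - k) k ^+ t.+1.
Proof.
(* [inord] never takes its default value here, since [z <= x] bounds the dimension. *)
rewrite (partition_big (fun z => inord (Bnt_dim z) : 'I_(Bnt_dim x).+1) predT) //=.
apply: eq_bigr => k _; rewrite -sum_Bnt_dim -1?ltnS ?ltn_ord // mulr_sumr.
have dimk z : (z <= x)%O -> (inord (Bnt_dim z) == k) = (Bnt_dim z == k).
  by move=> le_zx; rewrite -val_eqE /= inordK // ltnS Bnt_dim_le.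
apply: eq_big => [z|z /andP[le_zx]].
  by case le_zx : (z <= x)%O; rewrite //= dimk.
by rewrite dimk // => /eqP ->; rewrite mulr1.
Qed.

(** Strong induction on the dimension: the claimed values also sum to zero over the interval below
    any nonzero [x]. *)
Lemma mobius_Bnt x : mobius \bot%O x = (-1) ^+ Bnt_dim x * Wsum q t.+1 (Bnt_dim x).
Proof.
have [d] := ubnP (Bnt_dim x); elim: d x => // d IHd x; rewrite ltnS => le_xd.
have dim0 : Bnt_dim \bot%O = 0%N by rewrite /Bnt_dim tnth_mktuple dimv0.
have [x0|x_gt0] := posnP (Bnt_dim x).
  rewrite -(@Bnt_le_dim_eq x \bot%O) ?le0x ?dim0 //.
  by rewrite mobius_refl Wsum0 mulr1.
have lt0x : (\bot%O < x)%O.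
  rewrite lt_neqAle le0x andbT; apply/eqP => x0; move: x_gt0.
  by rewrite -x0 dim0.
pose f k := (-1) ^+ k * Wsum q t.+1 k.
have sum0 : \sum_(z | (z <= x)%O) f (Bnt_dim z) = 0.
  rewrite sum_Bnt_below; case: (Bnt_dim x) x_gt0 => // m _.
  rewrite -[RHS](alternating_qbinomial_Wsum q t.+1 m).
  by apply: eq_bigr => k _; rewrite mulrAC.
rewrite mobius_lt // -/(f _); apply/eqP; rewrite eq_sym -subr_eq0 opprK.
rewrite -[X in _ == X]sum0 [X in _ == X](bigD1 x) //=; apply/eqP; congr (_ + _).
apply: eq_big => [z|z /andP[_ lt_zx]]; first by rewrite le0x /= lt_neqAle andbC.
have le_zx := ltW lt_zx; rewrite IHd //; apply: leq_trans le_xd.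
rewrite ltn_neqAle Bnt_dim_le // andbT; apply/eqP => /(Bnt_le_dim_eq le_zx) eq_zx.
by rewrite eq_zx ltxx in lt_zx.
Qed.

End MobiusBnt.

Lemma Wsum_Wnt n t q : Wsum (q%:R : int) t n = (Wnt n t q)%:Z%R.
Proof.
rewrite /Wsum /Wnt -natz natr_sum; apply: eq_bigr => s _.
by rewrite natr_prod; apply: eq_bigr => k _; rewrite natrX.
Qed.

Unset Implicit Arguments.

Theorem theorem6p5 (q t n : nat) (hq : prime_power q) (ht : 1 <= t)
    (hn : 1 <= n) (F : finFieldType) (hF : #|F| = q) :
  mobius_number (Bnt F n t) = ((-1) ^ (n%:Z - 2) * (Wnt n t q)%:Z)%R.
Proof.
case: t ht => // t _; rewrite /mobius_number mobius_Bnt hF Wsum_Wnt.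
have -> : Bnt_dim (\top%O : Bnt F n t.+1) = n.
  by rewrite /Bnt_dim tnth_mktuple dimvf /dim /= mul1n.
(* The exponent is an integer; [-1] is a unit, so the factor [(-1)^(-2)] splits off and equals 1. *)
by rewrite exprzDr ?unitrN1 // -exprnP mulr1.
Qed.
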